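(* Let $G$ be a right partially ordered group or a left partially ordered group, with identity $e$ and positive cone $G^+ = \{x \in G : x > e\}$. Let $B$ be a nonempty subset of $G^+$. Let $J$ be a downward closed subset of $G^+$ such that $J^* = J \setminus B$ is nonempty and, for every $x \in J^*$, the set \[ B^*(x) = \{b \in B : b < x\} = (e,x) \cap B \] is nonempty and finite. Then there is a family $\{J_\ell : \ell \in L\}$ of pairwise disjoint nonempty subsets of $J^*$ with $J^* = \bigcup_{\ell \in L} J_\ell$ such that, for every $\ell \in L$, there exists $b_\ell \in B$ with the following properties: (i) if $G$ is right partially ordered, then $J_\ell b_\ell^{-1} = \{x b_\ell^{-1} : x \in J_\ell\}$ is a downward closed subset of $G^+$; (ii) if $G$ is left partially ordered, then $b_\ell^{-1} J_\ell = \{b_\ell^{-1} x : x \in J_\ell\}$ is a downward closed subset of $G^+$.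
   Context: A group $G$ with a partial order $\le$ is right partially ordered if $a \le b$ implies $ac \le bc$ for all $a,b,c\in G$, and left partially ordered if $a\le b$ implies $ca \le cb$ for all $a,b,c \in G$. We write $x<y$ if $x\le y$ and $x\ne y$. For $x \in G$, $(e,x) = \{y \in G : e < y < x\}$. A subset $J \subseteq G^+$ is downward closed if $x \in J$ implies $(e,x) \subseteq J$. *)

(* Defs.v *)
From HB Require Import structures.
From mathcomp Require Import all_boot all_order monoid interval.
From mathcomp Require Import all_classical.

Set Implicit Arguments.
Unset Strict Implicit.
Unset Printing Implicit Defensive.

Import Order.Theory.
Local Open Scope order_scope.
Local Open Scope group_scope.
Local Open Scope classical_set_scope.

(* A group and a partial order on the same carrier, with no compatibility
   between the two: right_ordered and left_ordered below are separate
   predicates. *)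
#[short(type="groupPOrderType")]
HB.structure Definition GroupPOrder (d : Order.disp_t) :=
  {G of Group G & Order.POrder d G}.

Section PartiallyOrderedGroup.
Context {d : Order.disp_t} (G : groupPOrderType d).
Implicit Types (B J : set G) (x : G).

Definition right_ordered : Prop :=
  forall a b c : G, a <= b -> a * c <= b * c.

Definition left_ordered : Prop :=
  forall a b c : G, a <= b -> c * a <= c * b.

Definition positive_cone : set G := [set x | 1 < x].

Definition downward_closed J : Prop :=
  J `<=` positive_cone /\ forall x, J x -> `]1, x[ `<=` J.

Definition below B x : set G := [set b | B b /\ b < x].

End PartiallyOrderedGroup.

Arguments positive_cone {d} G _.

(* Main.v *)
(* Assign to x in J* an element c x of B*(x) of maximal height, the height of b
   being the cardinality of B*(b), with ties broken by a well-ordering of G.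
   The parts are the fibres of c.  Since the height is strictly increasing,
   c x is maximal in B*(x); since the criterion is uniform, c z = c x whenever
   z < x and c x lies in B*(z).  If b = c x and 1 < y < x b^-1, then
   b < y b < x, so y b lies in J, not in B by maximality of b, and
   c (y b) = b.  The left ordered case is symmetric, with the same c. *)

Require Import Defs.
From HB Require Import structures.
From mathcomp Require Import all_boot all_order monoid.
From mathcomp Require Import all_classical.
From mathcomp Require Import finmap interval wochoice.

Set Implicit Arguments.
Unset Strict Implicit.
Unset Printing Implicit Defensive.

Import Order.Theory.

Local Open Scope order_scope.
Local Open Scope group_scope.
Local Open Scope classical_set_scope.

(** The choice takes the least element, for a fixed well-ordering, among those maximising [h]. If
    [S'] is contained in [S] and contains [c S], the maximum of [h] is the same on both, so
    maximisers in [S'] are maximisers in [S], and [c S] is still the least of them. *)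
Lemma consistent_argmax (T : eqType) (x0 : T) (h : T -> nat) :
  exists c : set T -> T, forall S : set T, S !=set0 ->
    (exists n, forall b, S b -> (h b <= n)%N) ->
    [/\ S (c S), forall b, S b -> (h b <= h (c S))%N
      & forall S' : set T, S' `<=` S -> S' (c S) -> c S' = c S].
Proof.
have [R woR] := well_ordering_principle T.
pose top S b := S b /\ forall b', S b' -> (h b' <= h b)%N.
(* When no maximum is attained, [x0] serves as a dummy value, which makes [c] total. *)
have selP (S : set T) : exists b, (exists b', top S b') ->
    minimum_of R [pred b | `[< top S b >]] b.
  have [[b' topb']|notop] := pselect (exists b', top S b'); last by exists x0.
  have [|b [minb _]] := woR [pred b | `[< top S b >]].
    by exists b'; apply/asboolP.
  by exists b.
have [c cP] := choice selP; exists c => S [s Ss] [n hn].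
have topS : exists b, top S b.
  have exk : exists k, `[< exists2 b, S b & h b = k >].
    by exists (h s); apply/asboolP; exists s.
  have lek k : `[< exists2 b, S b & h b = k >] -> (k <= n)%N.
    by move=> /asboolP[b Sb <-]; exact: hn.
  have [k /asboolP[b Sb <-] maxb] := ex_maxnP exk lek.
  by exists b; split=> // b' Sb'; apply: maxb; apply/asboolP; exists b'.
have [/asboolP[ScS hcS] minc] := cP S topS; split=> // S' S'S S'c.
have topS' : top S' (c S) by split=> // b' /S'S; exact: hcS.
(* Minima for [R] are unique, so it suffices that [c S] is also a minimum of the maximisers in
   [S']. *)
have [|b0 [_ uniq]] := woR [pred b | `[< top S' b >]].
  by exists (c S); apply/asboolP.
rewrite -(uniq (c S')); last by apply: cP; exists (c S).
apply: uniq; split; first exact/asboolP.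
move=> b /asboolP[S'b hb]; apply: minc; apply/asboolP; split; first exact: S'S.
by move=> b' /hcS /leq_trans; apply; exact: hb.
Qed.

Section PartiallyOrderedGroup.
Context {d : Order.disp_t} (G : groupPOrderType d).
Implicit Types (B : set G) (a b x y : G).

Lemma right_ordered_lt a b x : right_ordered G -> a < b -> a * x < b * x.
Proof.
move=> ro; rewrite !lt_neqAle => /andP[ab /ro ->]; rewrite andbT.
by apply: contra ab => /eqP/mulIg ->.
Qed.

Lemma left_ordered_lt a b x : left_ordered G -> a < b -> x * a < x * b.
Proof.
move=> lo; rewrite !lt_neqAle => /andP[ab /lo ->]; rewrite andbT.
by apply: contra ab => /eqP/mulgI ->.
Qed.

Lemma below_subset B x y : x <= y -> below B x `<=` below B y.
Proof. by move=> xy b [Bb bx]; split=> //; exact: lt_le_trans xy. Qed.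

(** [fset_set] sends an infinite set to the empty one, so this is the true cardinality only where
    [below B b] is finite. *)
Definition height B b : nat := #|` fset_set (below B b)|%fset.

(** The inclusion of [below B a] in [below B b] is strict because [a] lies only in the latter. *)
Lemma height_lt B a b : finite_set (below B b) -> B a -> a < b ->
  (height B a < height B b)%N.
Proof.
move=> finb Ba ab.
have fina : finite_set (below B a).
  exact: sub_finite_set (below_subset (ltW ab)) finb.
apply: fproper_ltn_card; rewrite fproperE; apply/andP; split.
  by rewrite -fset_set_sub//; exact/below_subset/ltW.
apply/fsubsetPn; exists a; rewrite in_fset_set//; first exact/mem_set.
by apply/negP => /set_mem[_]; rewrite ltxx.
Qed.

Lemma below_choice B : exists c : G -> G, forall x,
  below B x !=set0 -> finite_set (below B x) ->
  [/\ below B x (c x), forall b, below B x b -> ~ c x < b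
    & forall z, z < x -> below B z (c x) -> c z = c x].
Proof.
have [c cP] := consistent_argmax 1 (height B).
exists (fun x => c (below B x)) => x nex finx.
have [|[Bc cx] hmax csub] := cP (below B x) nex.
  (* The height of [x] itself, which need not lie in [B], bounds the heights of the elements below
     it. *)
  exists (height B x) => b [Bb bx]; exact: ltnW (height_lt finx Bb bx).
split=> // [b xb cb|z zx]; last exact/csub/below_subset/ltW.
have := hmax b xb; rewrite leqNgt => /negP; apply.
exact: height_lt (sub_finite_set (below_subset (ltW xb.2)) finx) Bc cb.
Qed.

End PartiallyOrderedGroup.

Theorem theorem3p1 (d : Order.disp_t) (G : groupPOrderType d) (B J : set G) :
  right_ordered G \/ left_ordered G ->
  B !=set0 ->
  B `<=` positive_cone G ->
  downward_closed J ->
  J `\` B !=set0 ->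
  (forall x : G, (J `\` B) x -> below B x !=set0 /\ finite_set (below B x)) ->
  exists (L : Type) (F : L -> set G),
    [/\ trivIset [set: L] F,
        forall l : L, F l !=set0,
        \bigcup_(l in [set: L]) F l = J `\` B
      & forall l : L, exists b : G,
          [/\ B b,
              right_ordered G ->
                downward_closed [set x * b^-1 | x in F l]
            & left_ordered G ->
                downward_closed [set b^-1 * x | x in F l]]].
Proof.
move=> _ _ Bpos [Jpos Jdown] _ fin; have [c cP] := below_choice B.
(* The labels are the values taken by [c] on J*, so that no fibre is empty. *)
pose F (l : {b | exists2 x, (J `\` B) x & c x = b}) : set G :=
  [set x | (J `\` B) x /\ c x = sval l].
exists _, F; split.
- move=> [b bP] [b' b'P] _ _ [x [[_ /= cb] [_ /= cb']]].
  by apply: eq_exist; rewrite -cb -cb'.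
- by move=> [b [x Jx cx]]; exists x.
- apply/seteqP; split=> [x [l _ []]//|x Jx].
  by exists (exist _ (c x) (ex_intro2 _ _ x Jx erefl)).
(* The order-theoretic core shared by both cases: with an element [x], a part contains everything
   strictly between its label and [x]. *)
have downF l x z : F l x -> sval l < z -> z < x -> F l z.
  move=> [[Jx nBx] cx] bz zx; have [nex finx] := fin x (conj Jx nBx).
  have [[Bc _] cmax csub] := cP x nex finx.
  split; last by rewrite -cx; apply: csub => //; split; rewrite // cx.
  split=> [|Bz]; last by apply: (cmax z) => //; rewrite cx.
  apply: (Jdown x Jx); rewrite /= in_itv/= zx andbT.
  by apply: lt_trans bz; apply: Bpos; rewrite -cx.
have belowF l x : F l x -> B (sval l) /\ sval l < x.
  by move=> [Jx <-]; have [nex finx] := fin x Jx; have [] := cP x nex finx.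
move=> l; exists (sval l); split.
- case: l => b [x Jx cx].
  by have [] := belowF (exist _ b (ex_intro2 _ _ x Jx cx)) x.
(* Right multiplication by the label b carries the interval from 1 to [x * b^-1] into the one from b
   to [x], where [downF] applies. *)
- move=> ro; split=> [_ [x Fx <-]|_ [x Fx <-] y].
    have [_ bx] := belowF l x Fx.
    by rewrite /positive_cone/= -(mulgV (sval l)); exact: right_ordered_lt.
  rewrite /= in_itv/= => /andP[y1 yx]; exists (y * sval l); last by rewrite mulgK.
  apply: downF Fx _ _.
    by rewrite -[X in X < _]mul1g; exact: right_ordered_lt.
  by rewrite -[X in _ < X](mulgVK (sval l)); exact: right_ordered_lt.
- move=> lo; split=> [_ [x Fx <-]|_ [x Fx <-] y].
    have [_ bx] := belowF l x Fx.
    by rewrite /positive_cone/= -(mulVg (sval l)); exact: left_ordered_lt.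
  rewrite /= in_itv/= => /andP[y1 yx]; exists (sval l * y); last by rewrite mulKg.
  apply: downF Fx _ _.
    by rewrite -[X in X < _]mulg1; exact: left_ordered_lt.
  by rewrite -[X in _ < X](mulVKg (sval l)); exact: left_ordered_lt.
Qed.
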